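(* Let $s\in(0,1)$, let $p$ satisfy conditions $(\mathrm P_1)$ and $(\mathrm P_2)$ stated in the context, and let $\Omega$ be a bounded domain in $\mathbb{R}^N$. Let $u\in C^{1,1}_{loc}(\mathbb{R}^N)\cap L_{sp(x,\cdot)}$ be lower semi-continuous on $\overline{\Omega}$ and satisfy $$(-\Delta)^s_{p(x,\cdot)}u(x)\ge 0 \quad\text{for } x\in\Omega,\qquad u(x)\ge 0\quad\text{for } x\in\mathbb{R}^N\setminus\Omega .$$ Then $u(x)\ge 0$ for all $x\in\Omega$. Moreover, if $u(x)=0$ at some point $x\in\Omega$, then $u=0$ almost everywhere in $\mathbb{R}^N$.
   Context: Conditions on the exponent. $(\mathrm P_1)$: $p:\mathbb{R}^{2N}=\mathbb{R}^N\times\mathbb{R}^N\to(2,+\infty)$ is continuous, with $1-\frac{1}{\ln(m)}<p^-:=\min_{(x,y)\in\mathbb{R}^{2N}}p(x,y)\le p(x,y)\le p^+:=\max_{(x,y)\in\mathbb{R}^{2N}}p(x,y)$ for some $0<m<1$, and $sp^+<N$. $(\mathrm P_2)$: there is a continuous function $Q:\mathbb{R}_+\to\mathbb{R}_+$ such that $p(x,y)=Q(|x-y|)$ for all $(x,y)\in\mathbb{R}^{2N}$, $Q$ is nondecreasing, and $t\mapsto t^{Q(t)}$ is increasing on $\mathbb{R}_+$. The fractional $p(x,\cdot)$-Laplacian is $$(-\Delta)^s_{p(x,\cdot)}u(x)=\text{p.v.}\int_{\mathbb{R}^N}\frac{|u(x)-u(y)|^{p(x,y)-2}(u(x)-u(y))}{|x-y|^{N+sp(x,y)}}\,dy,$$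 where p.v. denotes the Cauchy principal value, i.e. the limit as $\epsilon\to0^+$ of the integrals over $\mathbb{R}^N\setminus B_\epsilon(x)$. The notation $u\in L_{sp(x,\cdot)}$ means $u\in L^1_{loc}(\mathbb{R}^N)$ and $\int_{\mathbb{R}^N}\frac{|u(y)|^{p(x,y)-1}}{1+|y|^{N+sp(x,y)}}\,dy<\infty$ (for every $x\in\mathbb{R}^N$). $C^{1,1}_{loc}(\mathbb{R}^N)$ is the space of $C^1$ functions with locally Lipschitz gradient. *)

(* Defs.v *)
From HB Require Import structures.
From mathcomp Require Import all_boot all_order all_algebra.
From mathcomp Require Import all_classical all_reals all_analysis.

Set Implicit Arguments.
Unset Strict Implicit.
Unset Printing Implicit Defensive.

Import Order.TTheory GRing.Theory Num.Theory.
Import numFieldNormedType.Exports.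

Local Open Scope classical_set_scope.
Local Open Scope ring_scope.

Definition measure_rV_display : measure_display -> measure_display.
Proof. exact. Qed.

(* The sigma-algebra on row vectors is the product one, generated by the
   coordinates, as for the library's tuples. *)
Section measurable_rV.
Context {d} {T : sigmaRingType d}.
Variable n : nat.

Definition rV_coord (i : 'I_n) (x : 'rV[T]_n) : T := x ord0 i.

Let rV_set0 : g_sigma_preimage rV_coord set0.
Proof. exact: sigma_algebra0. Qed.

Let rV_setC A : g_sigma_preimage rV_coord A -> g_sigma_preimage rV_coord (~` A).
Proof. exact: sigma_algebraC. Qed.

Let rV_bigcup (F : _^nat) : (forall i, g_sigma_preimage rV_coord (F i)) ->
  g_sigma_preimage rV_coord (\bigcup_i (F i)).
Proof. exact: sigma_algebra_bigcup. Qed.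

HB.instance Definition _ := @isMeasurable.Build (measure_rV_display d)
  'rV[T]_n (g_sigma_preimage rV_coord) rV_set0 rV_setC rV_bigcup.

End measurable_rV.

Lemma measurable_rV_coord d (T : measurableType d) n (i : 'I_n) :
  measurable_fun [set: 'rV[T]_n] (fun x : 'rV[T]_n => x ord0 i).
Proof.
move=> _ Y mY; rewrite setTI; apply: sub_sigma_algebra.
case: n i => [[] []//|n i].
rewrite -bigcup_mkord_ord; exists i; first exact: ltn_ord.
by exists Y => //; rewrite setTI inord_val.
Qed.

Lemma measurable_fun_rVP d1 d2 (T1 : measurableType d1) (T2 : measurableType d2)
    n (f : T1 -> 'rV[T2]_n) :
  measurable_fun [set: T1] f <->
  forall i, measurable_fun [set: T1] (fun x => f x ord0 i).
Proof.
split=> [mf i|mf]; first exact: (measurableT_comp (measurable_rV_coord i) mf).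
apply: measurability => //.
case: n => [|n] in f mf *.
  by rewrite big_ord0 => _ [_ []].
move=> _ [B + <-]; rewrite -bigcup_mkord_ord => -[i Ii [A mA <-]].
have := mf (Ordinal Ii) measurableT _ mA.
rewrite !setTI -comp_preimage (_ : inord i = Ordinal Ii)//.
by apply/val_inj; rewrite /= inordK.
Qed.

Section rV_cons.
Context (R : realType) (n : nat).

Definition rV_cons (z : R * 'rV[R]_n) : 'rV[R]_n.+1 :=
  \row_i (if unlift ord0 i is Some j then z.2 ord0 j else z.1).

Definition rV_uncons (x : 'rV[R]_n.+1) : R * 'rV[R]_n :=
  (x ord0 ord0, \row_j x ord0 (lift ord0 j)).

Lemma rV_consK : cancel rV_cons rV_uncons.
Proof.
case=> a v; rewrite /rV_uncons /rV_cons/=; congr pair.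
  by rewrite mxE unlift_none.
by apply/rowP => j; rewrite !mxE liftK.
Qed.

Lemma rV_unconsK : cancel rV_uncons rV_cons.
Proof.
move=> x; apply/rowP => i; rewrite !mxE.
by case: unliftP => [j|] -> //=; rewrite mxE.
Qed.

Lemma measurable_rV_cons : measurable_fun setT rV_cons.
Proof.
apply/measurable_fun_rVP => i; under eq_fun do rewrite mxE.
case: unliftP => [j|] _.
- exact: (measurableT_comp (measurable_rV_coord j) measurable_snd).
- exact: measurable_fst.
Qed.

Lemma measurable_rV_uncons : measurable_fun setT rV_uncons.
Proof.
apply/measurable_fun_pairP; split; first exact: measurable_rV_coord.
apply/measurable_fun_rVP => i; rewrite /comp/=.
under eq_fun do rewrite mxE.
exact: measurable_rV_coord.
Qed.

End rV_cons.

Section lebesgueS.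
Context (R : realType) (n : nat).
Variable mu : {sigma_finite_measure set 'rV[R]_n -> \bar R}.

Definition lebesgueS : set 'rV[R]_n.+1 -> \bar R :=
  pushforward (@lebesgue_measure R \x mu)%E (@rV_cons R n).

Let lebesgueS_measure : {measure set 'rV[R]_n.+1 -> \bar R}.
Proof.
refine [the measure _ _ of
  pushforward (@lebesgue_measure R \x mu)%E (@rV_cons R n)].
exact: measurable_rV_cons.
Defined.

HB.instance Definition _ :=
  Measure.copy lebesgueS lebesgueS_measure.

Let lebesgueS_sigma_finite : sigma_finite setT lebesgueS.
Proof.
have /sigma_finiteP[F [FT ndF Foo]] := sigma_finiteT (@lebesgue_measure R).
have /sigma_finiteP[G [GT ndG Goo]] := sigma_finiteT mu.
exists (fun k => @rV_uncons R n @^-1` (F k `*` G k)).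
  apply/seteqP; split => // x _.
  have [i _ Fi] : (\bigcup_k F k) (x ord0 ord0) by rewrite -FT.
  have [j _ Gj] : (\bigcup_k G k) (rV_uncons x).2 by rewrite -GT.
  exists (maxn i j) => //; split => /=.
    by move: Fi; apply/subsetPset/ndF/leq_maxl.
  by move: Gj; apply/subsetPset/ndG/leq_maxr.
move=> k; have [mF Fk] := Foo k; have [mG Gk] := Goo k; split.
  rewrite -[X in measurable X]setTI.
  by apply: measurable_rV_uncons => //; exact: measurableX.
rewrite /lebesgueS /pushforward -comp_preimage (_ : _ \o _ = id); last first.
  by apply/funext => z; exact: rV_consK.
by rewrite preimage_id product_measure1E// lte_mul_pinfty// ge0_fin_numE.
Qed.

HB.instance Definition _ := Measure_isSigmaFinite.Build _ _ _ lebesgueS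
  lebesgueS_sigma_finite.

End lebesgueS.

Section lebesgue_rV.
Context (R : realType).

Fixpoint lebesgue_rV n : {sigma_finite_measure set 'rV[R]_n -> \bar R} :=
  match n with
  | 0 => [the {sigma_finite_measure set _ -> \bar R} of \d_(0 : 'rV[R]_0)]
  | m.+1 => [the {sigma_finite_measure set _ -> \bar R} of
             lebesgueS (lebesgue_rV m)]
  end.

Lemma lebesgue_rV_box n (A : 'I_n -> set R) :
  (forall i, measurable (A i)) ->
  lebesgue_rV n [set x | forall i, A i (x ord0 i)] =
  (\prod_(i < n) lebesgue_measure (A i))%E.
Proof.
elim: n A => [|n IHn] A mA.
  by rewrite big_ord0 /= diracE mem_set//= => -[].
have mB : measurable [set x : 'rV[R]_n | forall i, A (lift ord0 i) (x ord0 i)].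
  rewrite (_ : mkset _ = \bigcap_(i in [set: 'I_n])
    ((fun x : 'rV[R]_n => x ord0 i) @^-1` A (lift ord0 i))).
    apply: fin_bigcap_measurable => // i _.
    by rewrite -[X in measurable X]setTI; exact: measurable_rV_coord.
  by apply/seteqP; split => x /= h i; [move=> _|]; exact: h.
rewrite big_ord_recl -IHn// -product_measure1E//; last exact: (mA ord0).
rewrite /= /lebesgueS /pushforward.
congr (_ _); apply/seteqP; split => -[a v] /=.
  move=> h; split=> [|i].
    by have := h ord0; rewrite /rV_cons mxE unlift_none.
  by have := h (lift ord0 i); rewrite /rV_cons mxE liftK.
move=> [h0 h] i; rewrite /rV_cons mxE.
by case: unliftP => [j|] ->.
Qed.

End lebesgue_rV.

(* The library norm on 'rV[R]_n is the sup norm, which induces the same topology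
   and the same bounded sets; |x - y| in the operator has to be Euclidean. *)
Definition enorm (R : realType) n (x : 'rV[R]_n) : R :=
  Num.sqrt (\sum_(i < n) x ord0 i ^+ 2).

Section exponent.
Context (R : realType) (N : nat).
Implicit Types (s : R) (p : 'rV[R]_N * 'rV[R]_N -> R).

Definition is_minimum T (f : T -> R) a :=
  (exists z, f z = a) /\ forall z, a <= f z.

Definition is_maximum T (f : T -> R) a :=
  (exists z, f z = a) /\ forall z, f z <= a.

Definition condP1 s p :=
  [/\ continuous p, forall z, 2 < p z &
    exists pmin pmax,
      [/\ is_minimum p pmin, is_maximum p pmax,
          exists2 m, 0 < m < 1 & 1 - 1 / ln m < pmin &
          s * pmax < N%:R]].

(* [powR] satisfies 0 `^ a = 0 for a != 0, and Q 0 = p (x, x) is nonzero under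
   condP1, so t = 0 is harmless below. *)
Definition condP2 p :=
  exists Q : R -> R,
    [/\ {within `[0, +oo[, continuous Q},
        forall t, 0 <= t -> 0 <= Q t,
        forall x y, p (x, y) = Q (enorm (x - y)),
        {in `[0, +oo[ &, {homo Q : t t' / t <= t'}} &
        {in `[0, +oo[ &, {homo (fun t => t `^ Q t) : t t' / t < t'}}].

End exponent.

Section operator.
Context (R : realType) (N : nat).
Variables (s : R) (p : 'rV[R]_N * 'rV[R]_N -> R).
Implicit Type u : 'rV[R]_N -> R.

Definition fracpLap_integrand u (x y : 'rV[R]_N) : R :=
  `|u x - u y| `^ (p (x, y) - 2) * (u x - u y) /
  enorm (x - y) `^ (N%:R + s * p (x, y)).

Definition fracpLap_trunc u (x : 'rV[R]_N) (e : R) : \bar R :=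
  (\int[lebesgue_rV R N]_(y in [set y | (e <= enorm (y - x))%R])
    (fracpLap_integrand u x y)%:E)%E.

(* Principal value. [lim] is a total operator: it only has its meaning where the
   limit exists, which is the case at every point for u in C11loc and in_Lsp
   when p satisfies condP1 and condP2 and 0 < s < 1. *)
Definition fracpLap u (x : 'rV[R]_N) : \bar R :=
  lim (fracpLap_trunc u x e @[e --> 0^'+]).

Definition locally_integrable_rV u :=
  forall K, compact K -> (lebesgue_rV R N).-integrable K (EFin \o u).

Definition in_Lsp u :=
  locally_integrable_rV u /\
  forall x, (\int[lebesgue_rV R N]_y
    (`|u y| `^ (p (x, y) - 1) /
     (1 + enorm y `^ (N%:R + s * p (x, y))))%:E < +oo)%E.

End operator.

Section regularity.
Context (R : realType) (N : nat).
Implicit Type u : 'rV[R]_N -> R.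

Definition gradient u (x : 'rV[R]_N) : 'rV[R]_N :=
  \row_(i < N) 'D_(delta_mx ord0 i) u x.

Definition locally_lipschitz (f : 'rV[R]_N -> 'rV[R]_N) :=
  forall x : 'rV[R]_N, exists2 U, nbhs x U & [lipschitz f y | y in U].

Definition C11loc u :=
  [/\ forall x, differentiable u x, continuous (gradient u) &
      locally_lipschitz (gradient u)].

(* Semicontinuity of the restriction of u to A, for the topology of A: in
   [subspace A] the points outside A are isolated. *)
Definition lower_semicontinuous_on (A : set 'rV[R]_N) u :=
  @lower_semicontinuous (subspace A) R (EFin \o u).

Definition bounded_domain (Omega : set 'rV[R]_N) :=
  [/\ Omega !=set0, open Omega, connected Omega & bounded_set Omega].

End regularity.

(* Main.v *)
Require Import Defs.
From HB Require Import structures.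
From mathcomp Require Import all_boot all_order all_algebra.
From mathcomp Require Import all_classical all_reals all_analysis.
From mathcomp Require Import measurable_realfun.

Set Implicit Arguments.
Unset Strict Implicit.
Unset Printing Implicit Defensive.

Import Order.TTheory GRing.Theory Num.Theory.
Import numFieldNormedType.Exports.

Local Open Scope classical_set_scope.
Local Open Scope ring_scope.

(** The point is that the operator is nonpositive at a global minimum [x] of
    [u]: the integrand is then nonpositive at every [y]. The truncated integrals
    over [enorm (y - x) >= e] are therefore nonpositive and can only decrease
    when [e] decreases, so that their limit, the principal value, is below each
    of them. If this limit is nonnegative, then every truncated integral is 0,
    the integrand vanishes almost everywhere, and so [u] is almost everywhere
    equal to its minimum [u x]. This rigidity is [fracpLap_ge0_global_min].

    Suppose now that [u] is negative somewhere in [Omega]. By compactness [u]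
    has a minimum on the closure of [Omega]; this minimum is negative, so it is
    attained inside [Omega] and it is a global one because [u] is nonnegative
    outside. By rigidity [u] is almost everywhere equal to a negative constant,
    which is impossible as the complement of the bounded set [Omega] has
    positive measure ([ae_cst_ge0]). Once [u] is known to be nonnegative, a
    zero of [u] in [Omega] is a global minimum, and rigidity gives [u = 0]
    almost everywhere.

    The vanishing of a nonnegative function with zero integral requires its
    measurability. The sigma-algebra on row vectors is the product one, so this
    rests on the fact that it contains the open sets ([open_measurable_rV]). *)

(** * Borel measurability on row vectors *)

Lemma measurable_ball_rV (R : realType) n (x : 'rV[R]_n) (r : R) :
  0 < r -> measurable (ball x r).
Proof.
move=> r0.
rewrite (_ : ball x r = \bigcap_(i in [set: 'I_n])
    ((fun y : 'rV[R]_n => y ord0 i) @^-1` ball (x ord0 i) r)).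
  apply: fin_bigcap_measurable => // i _.
  rewrite -[X in measurable X]setTI.
  apply: measurable_rV_coord => //.
  by apply: open_measurable; exact: ball_open.
apply/seteqP; split => y /=.
  by move=> [_ xy] i _; exact: xy.
by move=> xy; split=> // i j; rewrite (ord1 i); exact: xy.
Qed.

(** Every open set is the union of the countably many balls with rational
    centre and radius 1/(k+1) that it contains, and the balls of the sup norm
    are measurable boxes. *)
Lemma open_measurable_rV (R : realType) n (U : set 'rV[R]_n) :
  open U -> measurable U.
Proof.
move=> oU.
pose B (z : 'rV[rat]_n * nat) := ball (map_mx (@ratr R) z.1) z.2.+1%:R^-1.
rewrite (_ : U = \bigcup_z if `[< B z `<=` U >] then B z else set0).
  apply: countable_bigcupT_measurable; first exact: countableP.
  by move=> z; case: ifP => _ //; exact: measurable_ball_rV.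
apply/seteqP; split => [x Ux|x [z _]]; last by case: ifPn => // /asboolP; apply.
have /nbhs_ballP[e /= e0 xeU] : nbhs x U by exact: open_nbhs_nbhs.
(* e/2 leaves room for the distance from x to the rational centre *)
have e20 : 0 < e / 2 by rewrite divr_gt0.
have [k _ /(_ _ (leqnn k)) ke] := near_infty_natSinv_lt (PosNum e20).
have /choice[q qx] : forall i, exists q : rat,
    ball (x ord0 i) k.+1%:R^-1 (ratr q : R).
  move=> i; have [|q] := @rat_in_itvoo R (x ord0 i) (x ord0 i + k.+1%:R^-1).
    by rewrite ltrDl invr_gt0.
  rewrite in_itv/= => /andP[xq qx]; exists q.
  by rewrite /ball/= ltr0_norm ?subr_lt0// opprB ltrBlDl.
have xq : ball x k.+1%:R^-1 (map_mx (@ratr R) (\row_i q i)).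
  by split=> [|i j]; rewrite ?invr_gt0// !mxE (ord1 i).
exists (\row_i q i, k) => //; case: ifPn => [_|/asboolPn]; first exact: ball_sym.
case => y qy; apply: xeU; rewrite [e]splitr.
apply: (ball_triangle (y := map_mx (@ratr R) (\row_i q i))).
  by apply: le_ball xq; exact: ltW.
by apply: le_ball qy; exact: ltW.
Qed.

Lemma continuous_measurable_rV (R : realType) n (f : 'rV[R]_n -> R) :
  continuous f -> measurable_fun setT f.
Proof.
move=> /continuousP cf; apply: (measurability _ (RGenOpens.measurableE R)).
move=> _ [_ [a [b ->]] <-]; rewrite setTI.
by apply: open_measurable_rV; apply: cf; exact: interval_open.
Qed.

Lemma measurable_fun_powR2 d (T : measurableType d) (R : realType) (f g : T -> R) :
  measurable_fun setT f -> measurable_fun setT g ->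
  measurable_fun setT (fun x => f x `^ g x).
Proof.
move=> mf mg; rewrite /powR; apply: measurable_fun_ifT => /=.
- exact: measurable_fun_eqr.
- have := measurable_fun_eqr mg (measurable_cst (0 : R)).
  by move=> /(@measurableT_comp _ _ _ _ _ _ (fun b : bool => b%:R : R)); exact.
- apply: measurableT_comp => //; apply: measurable_funM => //.
  exact: measurableT_comp.
Qed.

(** * The Euclidean norm *)

Section enorm.
Context (R : realType) (n : nat).
Implicit Types x y : 'rV[R]_n.

Lemma enormN x : enorm (- x) = enorm x.
Proof.
by rewrite /enorm; congr Num.sqrt; apply: eq_bigr => i _; rewrite mxE sqrrN.
Qed.

Lemma enorm_gt0 x : x != 0 -> 0 < enorm x.
Proof.
move=> x0; rewrite /enorm sqrtr_gt0 lt0r sumr_ge0 ?andbT; last first.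
  by move=> i _; exact: sqr_ge0.
apply: contra x0; rewrite psumr_eq0 => [/allP x0|i _]; last exact: sqr_ge0.
apply/eqP/rowP => i; rewrite mxE; apply/eqP.
by rewrite -[_ == _](sqrf_eq0 (x ord0 i)); apply: x0; rewrite mem_index_enum.
Qed.

Lemma measurable_enormB x : measurable_fun setT (fun y => enorm (y - x)).
Proof.
apply: (measurableT_comp (f := @Num.sqrt R)).
  by apply: continuous_measurable_fun; exact: sqrt_continuous.
apply: measurable_sum => i; apply: measurable_funX.
under eq_fun do rewrite !mxE.
by apply: measurable_funB => //; exact: measurable_rV_coord.
Qed.

End enorm.

(** * The operator at a global minimum *)

Section min_principle.
Context (R : realType) (N : nat) (s : R).
Variables (p : 'rV[R]_N * 'rV[R]_N -> R) (u : 'rV[R]_N -> R).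
Hypotheses (cp : continuous p) (cu : continuous u).
Local Notation mu := (lebesgue_rV R N).

Lemma measurable_fracpLap_integrand x :
  measurable_fun setT (fracpLap_integrand s p u x).
Proof.
have mpx : measurable_fun setT (fun y => p (x, y)).
  by apply: continuous_measurable_rV; have [_] := continuous_curry cp; exact.
have mux : measurable_fun setT (fun y => u x - u y).
  by apply: measurable_funB => //; exact: continuous_measurable_rV.
rewrite /fracpLap_integrand; apply: measurable_funM.
  apply: measurable_funM => //; apply: measurable_fun_powR2.
    exact: measurableT_comp.
  exact: measurable_funB.
under eq_fun do rewrite -powRN.
apply: measurable_fun_powR2.
  under eq_fun do rewrite -enormN opprB.
  exact: measurable_enormB.
apply: measurableT_comp => //; apply: measurable_funD => //.
exact: measurable_funM.
Qed.

Lemma fracpLap_integrand_le0 x y :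
  u x <= u y -> fracpLap_integrand s p u x y <= 0.
Proof.
move=> uxy; rewrite /fracpLap_integrand mulr_le0_ge0 ?invr_ge0 ?powR_ge0//.
by rewrite mulr_ge0_le0 ?powR_ge0// subr_le0.
Qed.

(** The kernel is positive off the diagonal, so only the factors depending
    on [u x - u y] can vanish. *)
Lemma fracpLap_integrand_eq0 x y :
  y != x -> fracpLap_integrand s p u x y = 0 -> u y = u x.
Proof.
move=> yx /eqP; rewrite /fracpLap_integrand mulf_eq0 invr_eq0 => /orP[|].
  by rewrite mulf_eq0 powR_eq0 normr_eq0 => /orP[/andP[+ _]|]; rewrite subr_eq0 => /eqP.
by rewrite gt_eqF// powR_gt0// enorm_gt0// subr_eq0 eq_sym.
Qed.

(** Monotonicity of the truncated integrals in [e] does two things: it makes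
    the principal value exist in the extended reals, and it puts the principal
    value below every truncation. The punctured space is the countable union of
    the domains of the truncations at 1/(k+1), and at [x] itself there is
    nothing to prove. *)
Lemma fracpLap_ge0_global_min x :
  (forall y, u x <= u y) -> (0 <= fracpLap s p u x)%E ->
  {ae mu, forall y, u y = u x}.
Proof.
move=> uxmin Lx.
pose D e := [set y : 'rV[R]_N | (e <= enorm (y - x))%R].
pose f y := (- fracpLap_integrand s p u x y)%:E.
have f0 y : (0 <= f y)%E by rewrite lee_fin oppr_ge0 fracpLap_integrand_le0.
have mf : measurable_fun setT f.
  apply/measurable_EFinP; apply: measurableT_comp => //.
  exact: measurable_fracpLap_integrand.
have mD e : measurable (D e).
  rewrite -[D e]setTI (_ : D e = (fun y => enorm (y - x)) @^-1` `[e, +oo[).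
    by apply: measurable_enormB.
  by apply/seteqP; split => y /=; rewrite in_itv/= andbT.
have truncE e : fracpLap_trunc s p u x e = (- \int[mu]_(y in D e) f y)%E.
  rewrite -integral_ge0N; last by move=> y _; exact: f0.
  by apply: eq_integral => y _; rewrite /f EFinN oppeK.
have truncS e e' : e <= e' ->
    (fracpLap_trunc s p u x e <= fracpLap_trunc s p u x e')%E.
  move=> ee'; rewrite !truncE leeN2; apply: ge0_subset_integral => //.
    exact: measurable_funTS.
  by move=> y /=; exact: le_trans.
have cvgT : cvg (fracpLap_trunc s p u x e @[e --> 0^'+]).
  apply: nondecreasing_at_right_is_cvge; near=> e => a b _ _; exact: truncS.
have int0 e : 0 < e -> (\int[mu]_(y in D e) f y = 0)%E.
  move=> e0; apply/eqP; rewrite eq_le integral_ge0 ?andbT; last first.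
    by move=> y _; exact: f0.
  rewrite -oppe_ge0 -truncE; apply: (le_trans Lx); apply: lime_le => //.
  near=> e'; apply: truncS; near: e'; exact: nbhs_right_le.
have aeD k : mu.-negligible (D k.+1%:R^-1 `&` [set y | u y <> u x]).
  have k0 : 0 < k.+1%:R^-1 :> R by rewrite invr_gt0.
  have mDf : measurable_fun (D k.+1%:R^-1) f by exact: measurable_funTS.
  have [+ _] := ae_eq_integral_abs mu (mD _) mDf.
  rewrite (eq_integral f) => [/(_ (int0 _ k0))|y _]; last by rewrite gee0_abs.
  apply: negligibleS => y /= [Dy uy] /(_ Dy)[/eqP].
  rewrite oppr_eq0 => /eqP fy; apply: uy; apply: fracpLap_integrand_eq0 fy.
  apply: contraTneq Dy => ->; rewrite subrr -ltNge.
  by rewrite /enorm big1 ?sqrtr0// => i _; rewrite mxE expr0n.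
apply: negligibleS (negligible_bigcup aeD) => y /= uy.
have yx : 0 < enorm (y - x).
  by apply: enorm_gt0; rewrite subr_eq0; apply/eqP => yx; apply: uy; rewrite yx.
have [k _ /(_ _ (leqnn k)) ky] := near_infty_natSinv_lt (PosNum yx).
by exists k => //; split=> //; exact: ltW.
Unshelve. all: by end_near. Qed.

End min_principle.

(** * Bounded sets *)

Lemma lebesgue_rV_unit_box (R : realType) n (a : R) :
  lebesgue_rV R n [set x | forall i, `[a, a + 1]%classic (x ord0 i)] = 1%E.
Proof.
rewrite (@lebesgue_rV_box _ _ (fun=> `[a, a + 1]%classic)) => [|i]; last first.
  exact: measurable_itv.
rewrite big1// => i _; rewrite lebesgue_measure_itv/= lte_fin ltrDl ltr01.
by rewrite -EFinB addrAC subrr add0r.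
Qed.

Lemma le_norm_coord (R : realType) n (x : 'rV[R]_n) i : x ord0 i <= `|x|.
Proof.
apply: le_trans (ler_norm _) _.
rewrite [leRHS]/Num.Def.normr/= mx_normrE.
by apply/bigmax_geP; right; exists (ord0, i).
Qed.

Lemma bounded_set_closure (R : realType) n (A : set 'rV[R]_n) :
  bounded_set A -> bounded_set (closure A).
Proof.
move=> [M [Mr AM]]; exists M; split=> // r /AM Ar y.
have cB : closed [set z : 'rV[R]_n | `|z| <= r].
  exact: (closed_comp (fun z _ => @norm_continuous _ _ z) (@closed_le _ r)).
by move/(closureS Ar); rewrite -((closure_id _).1 cB).
Qed.

(** The complement of a bounded set is not negligible, since it contains
    a far away unit box; so the sign of [u] off [A] is the sign of the
    almost everywhere constant value of [u]. In dimension 0 the complement of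
    [A] can be empty. *)
Lemma ae_cst_ge0 (R : realType) n (u : 'rV[R]_n -> R) (A : set 'rV[R]_n)
    (c : R) :
  (0 < n)%N -> bounded_set A -> (forall x, ~ A x -> 0 <= u x) ->
  {ae lebesgue_rV R n, forall y, u y = c} -> 0 <= c.
Proof.
move=> n0 [M [_ AM]] u0 aec; rewrite leNgt; apply/negP => c0.
pose a := `|M| + 2.
pose B := [set x : 'rV[R]_n | forall i, `[a, a + 1]%classic (x ord0 i)].
have mB : measurable B.
  rewrite (_ : B = \bigcap_(i in [set: 'I_n])
      ((fun x : 'rV[R]_n => x ord0 i) @^-1` `[a, a + 1]%classic)).
    apply: fin_bigcap_measurable => // i _.
    by rewrite -[X in measurable X]setTI; exact: measurable_rV_coord.
  by apply/seteqP; split => x /= h i; [move=> _|]; exact: h.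
have : (lebesgue_rV R n).-negligible B.
  apply: negligibleS aec => x Bx /= uxc.
  have nAx : ~ A x.
    move=> /(AM (`|M| + 1)); rewrite (le_lt_trans (ler_norm M)) ?ltrDl//.
    move=> /(_ isT) xM.
    have := Bx (Ordinal n0); rewrite /= in_itv/= => /andP[ax _].
    have := le_trans ax (le_trans (le_norm_coord _ _) xM).
    by rewrite lerD2l (ler_nat R 2 1).
  by have := u0 x nAx; rewrite uxc leNgt c0.
move=> /(measure_negligible mB) B0.
have : 1%E = 0%E :> \bar R.
  by rewrite -(@lebesgue_rV_unit_box R n a); exact: B0.
by move/eqP; rewrite onee_eq0.
Qed.

(** * The maximum principle *)

Theorem theorem3p1 (R : realType) (N : nat) (s : R)
    (p : 'rV[R]_N * 'rV[R]_N -> R) (Omega : set 'rV[R]_N) (u : 'rV[R]_N -> R)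
    (hs : 0 < s < 1) (hP1 : condP1 s p) (hP2 : condP2 p)
    (hOmega : bounded_domain Omega)
    (huC : C11loc u) (huL : in_Lsp s p u)
    (hulsc : lower_semicontinuous_on (closure Omega) u)
    (hLap : forall x, Omega x -> (0 <= fracpLap s p u x)%E)
    (hout : forall x, ~ Omega x -> 0 <= u x) :
  (forall x, Omega x -> 0 <= u x) /\
  ((exists2 x, Omega x & u x = 0) ->
   {ae lebesgue_rV R N, forall y, u y = 0}).
Proof.
have [_ _ _ bO] := hOmega.
have cu : continuous u.
  by move=> x; apply: differentiable_continuous; have [+ _ _] := huC.
have cp : continuous p by have [] := hP1.
have u0 x : Omega x -> 0 <= u x.
  move=> Ox; rewrite leNgt; apply/negP => ux0.
  have cO : compact (closure Omega).
    apply: bounded_closed_compact; last exact: closed_closure.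
    exact: bounded_set_closure.
  have [||z zO zmin] := @EVT_min_rV R N u _ _ cO.
  - by exists x; exact: subset_closure.
  - exact: continuous_subspaceT.
  have uz0 : u z < 0.
    by apply: le_lt_trans ux0; apply: zmin; rewrite inE; exact: subset_closure.
  have Oz : Omega z.
    by apply: contrapT => /hout; rewrite leNgt uz0.
  have zmin' y : u z <= u y.
    have [Oy|/hout] := pselect (Omega y); last exact/le_trans/ltW.
    by apply: zmin; rewrite inE; exact: subset_closure.
  have := fracpLap_ge0_global_min cp cu zmin' (hLap z Oz).
  (* condition P1 rules out dimension 0, as 0 < s * p (0, 0) <= s * pM < N *)
  have N0 : (0 < N)%N.
    have [_ p2 [pm [pM [_ [_ pMax] _ spM]]]] := hP1.
    rewrite -(ltr0n R); apply: lt_trans spM; apply: mulr_gt0.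
      by case/andP: hs.
    by apply: lt_le_trans (pMax (0, 0)); apply: lt_trans (p2 _).
  by move=> /(ae_cst_ge0 N0 bO hout); rewrite leNgt uz0.
split=> // -[x Ox ux0].
rewrite -ux0; apply: (fracpLap_ge0_global_min cp cu) => [y|]; last exact: hLap.
by rewrite ux0; have [/u0|/hout] := pselect (Omega y).
Qed.
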